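(* Let $\beta\in B$. If $K_\beta$ is finite on a nonempty open subset of $\mathbb R^d$, then $J_\beta$ is proper (not identically $+\infty$ and nowhere equal to $-\infty$), and $K_\beta$ is lower semicontinuous.
   Context: Setting. $(Z,\mathcal Z)$ is a measurable space with a $\sigma$-finite measure $\mu$, and $\varphi\colon Z\to\mathbb R^d$ is $\mathcal Z$-measurable (the moment mapping). $\Gamma$ is the class of functions $\gamma\colon\mathbb R\to(-\infty,+\infty]$ that are finite and strictly convex on $(0,+\infty)$, equal to $+\infty$ for $t<0$, and satisfy $\gamma(0)=\lim_{t\downarrow0}\gamma(t)$. $B$ is the class of functions $\beta\colon Z\times\mathbb R\to(-\infty,+\infty]$ such that $\beta(\cdot,t)$ is $\mathcal Z$-measurable for each $t\in\mathbb R$ and $\beta(z,\cdot)\in\Gamma$ for each $z\in Z$. Convention: an integral whose positive and negative parts are both infinite equals $+\infty$. $\mathcal G$ is the linear space of $\mathcal Z$-measurable $g\colon Z\to\mathbb R$ with $\varphi g$ $\mu$-integrable; $\mathcal G_a=\{g\in\mathcal G\colon\int_Z\varphi g\,d\mu=a\}$; the superscript $+$ denotes the subset of nonnegative functions. $H_\beta(g)=\int_Z\beta(z,g(z))\,\mu(dz)$ and $J_\beta(a)=\inf_{g\in\mathcal G_a^+}H_\beta(g)$, $a\in\mathbb R^d$ ($\inf\emptyset=+\infty$). With $\beta^*(z,r)=\sup_{t}[rt-\beta(z,t)]$, $K_\beta(\vartheta)=\int_Z\beta^*(z,\langle\vartheta,\varphi(z)\rangle)\,\mu(dz)$, $\vartheta\in\mathbb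 R^d$. *)

(* Defs.v *)
From HB Require Import structures.
From mathcomp Require Import all_boot all_order all_algebra.
From mathcomp Require Import all_classical all_reals all_analysis.
From mathcomp Require Import measurable_realfun.
Import Order.TTheory GRing.Theory Num.Theory.
Import numFieldNormedType.Exports.

Set Implicit Arguments.
Unset Strict Implicit.
Unset Printing Implicit Defensive.

Local Open Scope classical_set_scope.
Local Open Scope ring_scope.
Local Open Scope ereal_scope.

Section ConvexIntegrands.
Context {R : realType}.

Definition strictly_convex_on_pos (f : R -> \bar R) : Prop :=
  forall s t l : R, (0 < s)%R -> (0 < t)%R -> s != t -> (0 < l < 1)%R ->
    f ((1 - l) * s + l * t)%R < (1 - l)%:E * f s + l%:E * f t.

Definition Gamma : set (R -> \bar R) :=
  [set f | [/\ forall t, f t != -oo,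
               forall t : R, (0 < t)%R -> f t \is a fin_num,
               strictly_convex_on_pos f,
               forall t : R, (t < 0)%R -> f t = +oo
             & f t @[t --> 0%R^'+] --> f 0%R]].

Definition classB d (Z : measurableType d) : set (Z -> R -> \bar R) :=
  [set b : Z -> R -> \bar R | (forall t : R, measurable_fun [set: Z] (b ^~ t)) /\
           (forall z, Gamma (b z))].

Definition conjugate (f : R -> \bar R) (r : R) : \bar R :=
  ereal_sup [set (r * t)%:E - f t | t in [set: R]].

End ConvexIntegrands.

(* The library's [\int] is the difference of the integrals of the positive
   and negative parts, with [+oo - +oo = -oo]; here that case yields [+oo]. *)
Definition pintegral {R : realType} d (Z : measurableType d)
    (mu : {measure set Z -> \bar R}) (f : Z -> \bar R) : \bar R :=
  if (\int[mu]_z f^\+ z == +oo) && (\int[mu]_z f^\- z == +oo) then +oo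
  else \int[mu]_z f z.

Definition inner {R : realType} {n : nat} (u v : 'rV[R]_n) : R :=
  (\sum_(i < n) u ord0 i * v ord0 i)%R.

(* Measurability for the Borel sigma-algebra of R^n. *)
Definition measurable_rV {R : realType} d (Z : measurableType d) {n : nat}
    (phi : Z -> 'rV[R]_n) : Prop :=
  measurable_fun [set: Z]
    (phi : Z -> g_sigma_algebraType (@open 'rV[R]_n)).

Definition proper_ereal {R : realType} {T : Type} (f : T -> \bar R) : Prop :=
  (exists x, f x != +oo) /\ (forall x, f x != -oo).

Section MomentProblem.
Context {R : realType} d (Z : measurableType d) (n : nat).
Variables (mu : {measure set Z -> \bar R}) (phi : Z -> 'rV[R]_n).

Definition momG : set (Z -> R) :=
  [set g | measurable_fun [set: Z] g /\
     forall i, mu.-integrable [set: Z] (fun z => (phi z ord0 i * g z)%:E)].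

Definition momGa (a : 'rV[R]_n) : set (Z -> R) :=
  [set g | momG g /\
     forall i, \int[mu]_z (phi z ord0 i * g z)%:E = (a ord0 i)%:E].

Definition momGaplus (a : 'rV[R]_n) : set (Z -> R) :=
  [set g | momGa a g /\ forall z, (0 <= g z)%R].

Variable beta : Z -> R -> \bar R.

Definition Hfun (g : Z -> R) : \bar R := pintegral mu (fun z => beta z (g z)).

Definition Jfun (a : 'rV[R]_n) : \bar R :=
  ereal_inf [set Hfun g | g in momGaplus a].

Definition Kfun (theta : 'rV[R]_n) : \bar R :=
  pintegral mu (fun z => conjugate (beta z) (inner theta (phi z))).

End MomentProblem.

(* Main.v *)
Require Import Defs.
From HB Require Import structures.
From mathcomp Require Import all_boot all_order all_algebra.
From mathcomp Require Import all_classical all_reals all_analysis.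
From mathcomp Require Import measurable_realfun.
From mathcomp Require Import ring lra.
Import Order.TTheory GRing.Theory Num.Theory.
Import numFieldNormedType.Exports.

Set Implicit Arguments.
Unset Strict Implicit.
Unset Printing Implicit Defensive.

Local Open Scope classical_set_scope.
Local Open Scope ring_scope.
Local Open Scope ereal_scope.

(** Choose theta0 in the open set on which K is finite, a positive integrable
   function e (mu is sigma-finite), and a measurable g > 0 with countably many
   values such that r g(z) - beta(z, g(z)) is within e(z) of beta^*(z, r) at
   r = <theta0, phi(z)>.  Then g(z) is an e(z)-subgradient of beta^*(z, .) at r;
   testing it at theta0 + c e_i and theta0 - c e_i bounds c |phi_i g| by
   integrable functions, so g has finite moments, and beta(z, g(z)) is
   integrable as well.  Hence J is finite from above at the moment of g.
   Fenchel's inequality at theta0 gives H(g') >= <theta0, a> - K(theta0) for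
   every g' with moment a, so J > -oo.  Finally, <theta, phi> g - beta(., g)
   is an integrable minorant of beta^*(., <theta, phi>) whose integral is affine
   in theta; after subtracting it, Fatou's lemma yields lower semicontinuity. *)

(** If [y < x], some real lies strictly between them, even when one or both are infinite. *)
Lemma lee_lt_EFin (R : realFieldType) (x y : \bar R) :
  (forall c : R, c%:E < x -> c%:E <= y) -> x <= y.
Proof.
move=> xy; rewrite leNgt; apply/negP => yx.
suff [c /andP[yc cx]] : exists c : R, y < c%:E < x.
  by have := xy c cx; rewrite leNgt yc.
case: x y {xy} yx => [x| |] [y| |]//= yx.
- by exists ((y + x) / 2)%R; rewrite !lte_fin in yx *; rewrite !midf_lt.
- by exists (x - 1)%R; rewrite ltNyr lte_fin ltrBlDr ltrDl ltr01.
- by exists (y + 1)%R; rewrite ltry lte_fin ltrDl ltr01.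
- by exists 0%R; rewrite ltNyr ltry.
Qed.

(** * Conjugates as suprema over positive rationals *)

Section conjugate_theory.
Context {R : realType}.
Implicit Types (f : R -> \bar R) (r t : R).

Lemma conjugate_ubound f r t : (r * t)%:E - f t <= conjugate f r.
Proof. by apply: ereal_sup_ubound; exists t. Qed.

(* The junk value 1 keeps [posrat] positive for every index. *)
Definition posrat (n : nat) : R :=
  if unpickle n is Some q then (if (0 < q :> rat)%R then ratr q else 1%R)
  else 1%R.

Lemma posrat_gt0 n : (0 < posrat n)%R.
Proof.
rewrite /posrat; case: unpickle => [q|]; last exact: ltr01.
by case: ifP => // q0; rewrite ltr0q.
Qed.

Lemma posrat_dense (a b : R) : (0 <= a)%R -> (a < b)%R ->
  exists n, (a < posrat n < b)%R.
Proof.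
move=> a0 ab; have [q /[!in_itv]/= /andP[aq qb]] := rat_in_itvoo ab.
exists (pickle q); rewrite /posrat pickleK.
by rewrite -(ltr0q R) (le_lt_trans a0 aq) aq.
Qed.

Lemma Gamma_neqNy f t : Gamma f -> f t != -oo.
Proof. by case. Qed.

Lemma Gamma_fin_num f t : Gamma f -> (0 < t)%R -> f t \is a fin_num.
Proof. by case=> _ + _ _ _; apply. Qed.

(** A negative [t] contributes [-oo], and the value at [t = 0] is the limit of the values from the
    right. *)
Lemma Gamma_conjugate_pos f r c : Gamma f -> c%:E < conjugate f r ->
  exists2 t : R, (0 < t)%R & c%:E < (r * t)%:E - f t.
Proof.
move=> Gf /ereal_sup_gt[_ [t _ <-]] ct.
have [t0|t0|t0] := ltgtP t 0%R; last 1 first.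
- move: ct; rewrite t0 => ct.
  have cv : ((r * s)%:E - f s) @[s --> 0%R^'+] --> (r * 0)%:E - f 0%R.
    apply: cvgeB; first by [].
    - apply: cvg_EFin; first exact: nearW.
      apply: cvgMl_tmp.
      by apply: cvg_at_right_filter; exact: cvg_id.
    - by case: Gf.
  have : \forall s \near 0%R^'+, c%:E < (r * s)%:E - f s.
    exact: (cv _ (open_ereal_gt' ct)).
  move=> cs; near (0:R)^'+ => s.
  by exists s => //; near: s; exact: cs.
- by case: Gf => _ _ _ /(_ _ t0) ft _; move: ct; rewrite ft addeNy.
- by exists t.
Unshelve. all: by end_near. Qed.

Lemma Gamma_conjugate_approx f r c : Gamma f -> c%:E < conjugate f r ->
  exists n, c%:E < (r * posrat n)%:E - f (posrat n).
Proof.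
move=> Gf /(Gamma_conjugate_pos Gf)[t t0].
have t10 : (0 < t + 1)%R by rewrite addr_gt0.
have := Gamma_fin_num Gf t10; have := Gamma_fin_num Gf t0.
case E1 : (f t) => [a| |]// _; case E2 : (f (t + 1)%R) => [b| |]// _.
rewrite -EFinB lte_fin => cra.
(* Moving right by [l] changes the chord's lower bound for [r q - f q] by [l (r + a - b)]. [M]
   bounds this slope and the added 1 keeps it positive; [del] keeps [l < 1] and the loss below the
   slack [r t - a - c]. *)
pose M := (`|r + a - b| + 1)%R.
have M0 : (0 < M)%R by rewrite ltr_wpDl.
pose del := Num.min 1%R ((r * t - a - c) / M)%R.
have del0 : (0 < del)%R by rewrite lt_min ltr01/= divr_gt0// subr_gt0.
have [n /andP[tn nt]] : exists n, (t < posrat n < t + del)%R.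
  by apply: posrat_dense; [exact: ltW|rewrite ltrDl].
(* Approaching t from the right, convexity on [t, t + 1] gives the upper
   bound (1 - l) f(t) + l f(t + 1) for f(t + l). *)
exists n; set q := posrat n in tn nt *.
pose l := (q - t)%R.
have l0 : (0 < l)%R by rewrite subr_gt0.
have ldel : (l < del)%R by rewrite ltrBlDl.
have l1 : (l < 1)%R by rewrite (lt_le_trans ldel)// ge_min lexx.
have lM : (l * M < r * t - a - c)%R.
  by rewrite -ltr_pdivlMr// (lt_le_trans ldel)// ge_min lexx orbT.
have := Gamma_fin_num Gf (posrat_gt0 n).
have [_ _ /(_ t (t + 1)%R l t0 t10) + _ _] := Gf.
have -> : ((1 - l) * t + l * (t + 1) = q)%R by rewrite /l; ring.
rewrite E1 E2 l0 l1 => /(_ _ isT).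
have -> : t != (t + 1)%R by rewrite lt_eqF// ltrDl.
move=> /(_ isT); case: (f q) => [fq| |]// + _.
rewrite -!EFinM -EFinD -EFinB !lte_fin => fql.
have : (`|l * (r + a - b)| <= l * M)%R.
  by rewrite normrM (gtr0_norm l0) ler_wpM2l// /M ?lerDl// ltW.
rewrite ler_norml => /andP[lM1 _].
have -> : q = (t + l)%R by rewrite /l; ring.
nra.
Qed.

(** A countable supremum makes the conjugate measurable in [z], as [beta] is measurable for each
    fixed [t]. *)
Lemma Gamma_conjugateE f r : Gamma f ->
  conjugate f r = esups (fun n => (r * posrat n)%:E - f (posrat n)) 0%N.
Proof.
move=> Gf; apply/eqP; rewrite eq_le; apply/andP; split.
  apply: lee_lt_EFin => c /(Gamma_conjugate_approx Gf)[n cn].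
  by apply: (le_trans (ltW cn)); apply: ereal_sup_ubound; exists n.
by apply: ge_ereal_sup => _ [n _ <-]; exact: conjugate_ubound.
Qed.

Lemma Gamma_conjugate_neqNy f r : Gamma f -> conjugate f r != -oo.
Proof.
move=> Gf; rewrite gt_eqF// (lt_le_trans _ (conjugate_ubound f r 1))//.
have := Gamma_fin_num Gf (@ltr01 R).
by case: (f 1%R) => // a _; rewrite -EFinB ltNyr.
Qed.

End conjugate_theory.

(** * Measurable selection, weights and integrability criteria *)

Section measure_theory_complements.
Context d (T : measurableType d) (R : realType).

(** [N z] is the first index [n] with [A n z]: the sets [seqDU A n] are disjoint and measurable, and
    on each of them the composite is a single [u n]. One [N] serves all families [u] at once. *)
Lemma measurable_selection (A : (set T)^nat) :
  (forall n, measurable (A n)) -> \bigcup_n A n = [set: T] ->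
  exists N : T -> nat, (forall z, A (N z) z) /\
    forall d' (T' : measurableType d') (u : nat -> T -> T'),
      (forall n, measurable_fun [set: T] (u n)) ->
      measurable_fun [set: T] (fun z => u (N z) z).
Proof.
move=> mA UA.
have ex z : {n | seqDU A n z}.
  apply: cid; have : [set: T] z by [].
  by rewrite -UA seqDU_bigcup_eq => -[n _ ?]; exists n.
exists (fun z => sval (ex z)); split=> [z|d' T' u mu].
  by case: (ex z) => n nz; exact: subset_seqDU nz.
rewrite -UA seqDU_bigcup_eq; apply/measurable_fun_bigcup => n.
  exact: seqDU_measurable.
have mun : measurable_fun (seqDU A n) (u n) by exact: measurable_funTS.
apply: eq_measurable_fun mun => z; rewrite inE => nz.
case: (ex z) => m /= mz; suff -> : m = n by [].
by apply: (@trivIset_seqDU _ A) => //; exists z.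
Qed.

(* Unlike [ge0_le_integral], no measurability is required: this is needed for
   z |-> beta z (g z), beta being measurable only for each fixed t. *)
Lemma ge0_le_integral_nonmeas (mu : {measure set T -> \bar R})
    (f g : T -> \bar R) :
  (forall z, 0 <= f z) -> (forall z, f z <= g z) ->
  \int[mu]_z f z <= \int[mu]_z g z.
Proof.
move=> f0 fg; have g0 z : 0 <= g z by exact: le_trans (fg z).
rewrite !ge0_integralTE//; apply: ereal_sup_le => _ [h /= hf <-].
by exists h => // z; exact: le_trans (fg z).
Qed.

Lemma sigma_finite_integrable_gt0 (mu : {measure set T -> \bar R}) :
  sigma_finite [set: T] mu ->
  exists e : T -> R, [/\ measurable_fun [set: T] e, forall z, (0 < e z)%R &
    mu.-integrable [set: T] (EFin \o e)].
Proof.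
move=> [F UF mF].
have [N [FN mN]] := measurable_selection (fun n => (mF n).1) (esym UF).
(* The weight makes [w n] times the measure of [F n] at most [1 / 2 ^ n.+1]; the added 1 covers null
   sets. *)
pose w n : R := (1 / (2 ^ n.+1)%:R / (1 + fine (mu (F n))))%R.
have muF0 n : (0 < 1 + fine (mu (F n)))%R by rewrite ltr_pwDl// fine_ge0.
have w0 n : (0 < w n)%R by rewrite !divr_gt0// ltr0n expn_gt0.
have me : measurable_fun [set: T] (fun z => w (N z)).
  by apply: (mN _ _ (fun n z => w n)) => n; exact: measurable_cst.
exists (fun z => w (N z)); split => //.
apply/integrableP; split; first exact/measurable_EFinP.
have mw n : measurable_fun [set: T] (fun z => (w n * \1_(F n) z)%:E).
  apply/measurable_EFinP/measurable_funM => //.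
  exact/measurable_indic/(mF n).1.
have w1 n z : 0 <= (w n * \1_(F n) z)%:E by rewrite lee_fin mulr_ge0// ltW.
(* Since [z] lies in [F (N z)], the value [w (N z)] is one term of this nonnegative series. *)
apply: (@le_lt_trans _ _ (\int[mu]_z \sum_(n <oo) (w n * \1_(F n) z)%:E)).
  apply: ge0_le_integral_nonmeas => // z.
  rewrite /= gtr0_norm//.
  rewrite (@nneseriesD1 _ _ (N z))//.
  by rewrite indicE mem_set//= mulr1 leeDl// nneseries_ge0.
rewrite integral_nneseries//.
apply: (@le_lt_trans _ _ (\sum_(n <oo) (1 / (2 ^ n.+1)%:R)%:E)).
  apply: lee_nneseries => [n _ _|n _]; first exact: integral_ge0.
  under eq_integral do rewrite EFinM.
  rewrite ge0_integralZl_EFin//; last 2 first.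
  - exact/measurable_EFinP/measurable_indic/(mF n).1.
  - exact: ltW.
  rewrite integral_indic//; last exact: (mF n).1.
  rewrite setIT -(@fineK _ (mu (F n))); last by rewrite ge0_fin_numE// (mF n).2.
  rewrite -EFinM lee_fin /w -[leLHS]mulrA ger_pMr ?divr_gt0 ?ltr0n ?expn_gt0//.
  by rewrite mulrC ler_pdivrMr// mul1r lerDr.
by apply: (le_lt_trans (epsilon_trick0 _ (@ler01 R))); rewrite ltry.
Qed.

Variable mu : {measure set T -> \bar R}.
Implicit Types f h : T -> \bar R.

Lemma integrable_neg_lty f : mu.-integrable [set: T] f ->
  \int[mu]_z f^\- z < +oo.
Proof.
by move=> /integrable_funeneg fi; apply: integrable_lty => //; exact: fi.
Qed.

Lemma pintegral_integrable f : mu.-integrable [set: T] f ->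
  pintegral mu f = \int[mu]_z f z.
Proof.
move=> fi; rewrite /pintegral ifF//.
by rewrite (lt_eqF (integrable_neg_lty fi)) andbF.
Qed.

(** Compare positive and negative parts; the case with both infinite is trivial by the convention.
    No measurability of [f] is asked, so it applies to [beta z (g z)] for every competitor [g]. *)
Lemma le_integral_pintegral h f : mu.-integrable [set: T] h ->
  (forall z, h z <= f z) -> \int[mu]_z h z <= pintegral mu f.
Proof.
move=> ih hf; rewrite /pintegral; case: ifPn => // _; first by rewrite leey.
rewrite integralE [leRHS]integralE leeB//; apply: ge0_le_integral_nonmeas => // z.
  by apply: (@funepos_le _ _ setT) => //; rewrite inE.
by apply: (@funeneg_le _ _ setT) => //; rewrite inE.
Qed.

(** The minorant bounds the negative part, so the upper bound on the value can only hold if the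
    positive part is finite too. *)
Lemma pintegral_lty_integrable h f : mu.-integrable [set: T] h ->
  (forall z, h z <= f z) -> measurable_fun [set: T] f ->
  pintegral mu f < +oo -> mu.-integrable [set: T] f.
Proof.
move=> ih hf mf Kf; apply/integrableP; split => //.
have fn : \int[mu]_z f^\- z < +oo.
  apply: le_lt_trans (integrable_neg_lty ih).
  apply: ge0_le_integral_nonmeas => // z.
  by apply: (@funeneg_le _ _ setT) => //; rewrite inE.
have fp : \int[mu]_z f^\+ z < +oo.
  rewrite ltey; apply/eqP => fp; move: Kf.
  rewrite /pintegral (lt_eqF fn) andbF integralE fp.
  have : \int[mu]_z f^\- z \is a fin_num by rewrite ge0_fin_numE// integral_ge0.
  by case: (\int[mu]_z f^\- z).
rewrite (eq_integral (fun z => f^\+ z + f^\- z)); last first.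
  by move=> z _; rewrite -[LHS]/((abse \o f) z) fune_abse.
rewrite ge0_integralD//; [exact: lte_add_pinfty| |].
  exact: measurable_funepos.
exact: measurable_funeneg.
Qed.

Lemma pintegral_fin_num_integrable f : measurable_fun [set: T] f ->
  pintegral mu f \is a fin_num -> mu.-integrable [set: T] f.
Proof.
move=> mf; rewrite /pintegral; case: ifPn => // _.
rewrite integralE => fK; apply/integrableP; split => //.
rewrite (eq_integral (fun z => f^\+ z + f^\- z)); last first.
  by move=> z _; rewrite -[LHS]/((abse \o f) z) fune_abse.
rewrite ge0_integralD//; [|exact: measurable_funepos|exact: measurable_funeneg].
have : 0 <= \int[mu]_z f^\+ z by exact: integral_ge0.
have : 0 <= \int[mu]_z f^\- z by exact: integral_ge0.
by move: fK; case: (\int[mu]_z f^\+ z) => [p| |]//;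
  case: (\int[mu]_z f^\- z) => [q| |]// *; rewrite -EFinD ltry.
Qed.

End measure_theory_complements.

(** * The pairing with the moment mapping *)

Section inner_theory.
Context {R : realType} {n : nat}.
Implicit Types u v theta : 'rV[R]_n.

Lemma innerDZ_delta theta c i v :
  inner (theta + c *: delta_mx ord0 i) v = (inner theta v + c * v ord0 i)%R.
Proof.
rewrite /inner (bigD1 i)//= [in RHS](bigD1 i)//= !mxE !eqxx mulr1.
rewrite mulrDl addrAC; congr (_ + _ + _)%R; apply: eq_bigr => j /negPf ji.
by rewrite !mxE ji andbF mulr0 addr0.
Qed.

Lemma continuous_innerl v : continuous (fun u => inner u v : R).
Proof.
apply: continuous_big => [|i _ u]; first exact: add_continuous.
by apply: (@cvgMr_tmp _ _ (nbhs u)); exact: (@coord_continuous _ 1 n ord0 i u).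
Qed.

Context d (Z : measurableType d).
Variable phi : Z -> 'rV[R]_n.
Hypothesis phi_meas : measurable_rV phi.

(** Coordinates are continuous, so preimages of open rays, which generate the Borel sets of the
    line, are open. *)
Lemma measurable_coord_rV i :
  measurable_fun [set: Z] (fun z => phi z ord0 i).
Proof.
apply: (measurability _ (RGenOInfty.measurableE R)).
move=> _ [_ [x ->] <-].
pose B : set (g_sigma_algebraType (@open 'rV[R]_n)) :=
  (fun v : 'rV[R]_n => v ord0 i) @^-1` `]x, +oo[%classic.
suff mB : measurable B by exact: (phi_meas measurableT mB).
apply: sub_sigma_algebra; apply: open_comp; last exact: interval_open.
by move=> v _; exact: (@coord_continuous _ 1 n ord0 i v).
Qed.

Lemma measurable_inner theta :
  measurable_fun [set: Z] (fun z => inner theta (phi z)).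
Proof.
apply: measurable_sum => i; apply: measurable_funM => //.
exact: measurable_coord_rV.
Qed.

Variable mu : {measure set Z -> \bar R}.
Implicit Types g : Z -> R.

Let inner_mulE theta g z : (inner theta (phi z) * g z)%:E =
  \sum_(i < n) (theta ord0 i)%:E * (phi z ord0 i * g z)%:E.
Proof.
rewrite /inner mulr_suml -sumEFin; apply: eq_bigr => i _.
by rewrite -EFinM mulrA.
Qed.

Lemma integrable_inner_mul theta g : momG mu phi g ->
  mu.-integrable [set: Z] (fun z => (inner theta (phi z) * g z)%:E).
Proof.
move=> [_ gi]; under eq_fun do rewrite inner_mulE.
by apply: integrable_sum => // i _; exact: integrableZl.
Qed.

Lemma integral_inner_mul theta g a : momGa mu phi a g ->
  \int[mu]_z (inner theta (phi z) * g z)%:E = (inner theta a)%:E.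
Proof.
move=> [[_ gi] ga]; under eq_integral do rewrite inner_mulE.
rewrite integral_sum//; last by move=> i; exact: integrableZl.
rewrite /inner -sumEFin; apply: eq_bigr => i _.
by rewrite integralZl// ga -EFinM.
Qed.

End inner_theory.

(** * Near-maximizers and a density of finite cost *)

Section convex_integrand.
Context (R : realType) d (Z : measurableType d).
Variable beta : Z -> R -> \bar R.
Hypothesis betaB : classB beta.

Let abse_neqNy (x : \bar R) : `|x| != -oo.
Proof. by case: x. Qed.

Let betaG z : Gamma (beta z). Proof. exact: betaB.2. Qed.

Lemma measurable_conjugate (r : Z -> R) : measurable_fun [set: Z] r ->
  measurable_fun [set: Z] (fun z => conjugate (beta z) (r z)).
Proof.
move=> mr; pose u n z := (r z * posrat n)%:E - beta z (posrat n).
rewrite (_ : (fun z => _) = fun z => esups (u ^~ z) 0%N); last first.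
  by apply/funext => z; exact: Gamma_conjugateE.
apply: measurable_fun_esups => n; apply: emeasurable_funB.
  by apply/measurable_EFinP/measurable_funM => //; exact: measurable_cst.
exact: betaB.1.
Qed.

Lemma measurable_near_maximizer (r e : Z -> R) :
  measurable_fun [set: Z] r -> measurable_fun [set: Z] e ->
  (forall z, (0 < e z)%R) ->
  exists g : Z -> R, [/\ measurable_fun [set: Z] g, forall z, (0 < g z)%R,
    measurable_fun [set: Z] (fun z => beta z (g z)) &
    forall z, conjugate (beta z) (r z) != +oo ->
      conjugate (beta z) (r z) <= (r z * g z)%:E - beta z (g z) + (e z)%:E].
Proof.
move=> mr me e0; pose C z := conjugate (beta z) (r z).
have mC : measurable_fun [set: Z] C by exact: measurable_conjugate.
pose v n z := (r z * posrat n)%:E - beta z (posrat n) + (e z)%:E.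
have mv n : measurable_fun [set: Z] (v n).
  apply: emeasurable_funD; last exact/measurable_EFinP.
  apply: emeasurable_funB; last exact: betaB.1.
  by apply/measurable_EFinP/measurable_funM => //; exact: measurable_cst.
(* Where [C z = +oo] no index need be nearly optimal; adding these points to every [A n] makes the
   sets cover [Z]. *)
pose A n := [set z | C z <= v n z] `|` C @^-1` [set +oo].
have mA n : measurable (A n).
  apply: measurableU.
    by rewrite -[X in measurable X]setTI; exact: measurable_lee.
  by rewrite -[X in measurable X]setTI; exact: mC.
have UA : \bigcup_n A n = [set: Z].
  apply/seteqP; split => // z _.
  have [Coo|Cnoo] := eqVneq (C z) +oo; first by exists 0%N => //; right.
  have [c Cc] : exists c, C z = c%:E.
    have := Gamma_conjugate_neqNy (r z) (betaG z).
    by move: Cnoo; rewrite /C; case: (conjugate _ _) => // c; exists c.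
  have : (c - e z)%:E < C z by rewrite Cc lte_fin ltrBlDr ltrDl.
  move=> /(Gamma_conjugate_approx (betaG z))[n cn].
  exists n => //; left; rewrite /= Cc /v.
  by rewrite -leeBlDr// -EFinB ltW.
have [N [AN mN]] := measurable_selection mA UA.
exists (fun z => posrat (N z)); split.
- by apply: (mN _ _ (fun n z => posrat n)) => n; exact: measurable_cst.
- by move=> z; exact: posrat_gt0.
- by apply: (mN _ _ (fun n z => beta z (posrat n))) => n; exact: betaB.1.
- by move=> z /eqP Cz; have [] := AN z.
Qed.

Context {n : nat}.
Variables (phi : Z -> 'rV[R]_n) (mu : {measure set Z -> \bar R}).
Hypothesis phi_meas : measurable_rV phi.

Let Kint theta z := conjugate (beta z) (inner theta (phi z)).

Let mKint theta : measurable_fun [set: Z] (Kint theta).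
Proof. exact/measurable_conjugate/measurable_inner. Qed.

Lemma Kfun_fin_num_integrable theta : Kfun mu phi beta theta \is a fin_num ->
  mu.-integrable [set: Z] (fun z => conjugate (beta z) (inner theta (phi z))).
Proof. by apply: pintegral_fin_num_integrable; exact: mKint. Qed.

Lemma finite_cost_density (U : set 'rV[R]_n) :
  sigma_finite [set: Z] mu -> open U -> U !=set0 ->
  (forall theta, U theta -> Kfun mu phi beta theta \is a fin_num) ->
  exists g : Z -> R, [/\ momG mu phi g, forall z, (0 < g z)%R &
    mu.-integrable [set: Z] (fun z => beta z (g z))].
Proof.
move=> sfmu openU [theta0 U0] Ufin.
have KU theta : U theta -> mu.-integrable [set: Z] (Kint theta).
  by move=> /Ufin; exact: Kfun_fin_num_integrable.
have [c c0 Uc] : exists2 c : R, (0 < c)%R & forall i,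
    U (theta0 + c *: delta_mx ord0 i)%R /\ U (theta0 + - c *: delta_mx ord0 i)%R.
  have /nbhs_ballP[eps eps0 epsU] : nbhs theta0 U by exact: open_nbhs_nbhs.
  (* Balls are taken coordinatewise and [delta_mx] has entries 0 and 1, so a step shorter than [eps]
     stays in [U]. *)
  exists (eps / 2)%R; first by rewrite divr_gt0.
  have b x i : (`|x| < eps)%R -> U (theta0 + x *: delta_mx ord0 i)%R.
    move=> xe; apply: epsU; split => // k l; rewrite !mxE /ball/=.
    rewrite opprD addrA subrr sub0r normrN normrM.
    by rewrite (le_lt_trans _ xe)// ler_piMr// normr_nat; case: (_ && _).
  move=> i; have e2 : (`|eps / 2| < eps)%R.
    by rewrite gtr0_norm ?divr_gt0// ltr_pdivrMr// ltr_pMr// ltr1n.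
  by split; apply: b; rewrite ?normrN.
have [e [me e0 ie]] := sigma_finite_integrable_gt0 sfmu.
have [g [mg g0 mb gmax]] := measurable_near_maximizer
  (measurable_inner phi_meas theta0) me e0.
have bE z : beta z (g z) = (fine (beta z (g z)))%:E.
  by rewrite fineK//; apply: Gamma_fin_num.
have Kge theta z : (inner theta (phi z) * g z)%:E - beta z (g z) <= Kint theta z.
  exact: conjugate_ubound.
have Gg : momG mu phi g.
  split=> // i; have [Up Um] := Uc i.
  pose W z := `|Kint (theta0 + c *: delta_mx ord0 i)%R z| +
     `|Kint (theta0 + - c *: delta_mx ord0 i)%R z| + `|Kint theta0 z| + (e z)%:E.
  have iW : mu.-integrable [set: Z] W.
    by apply: integrableD => //; do ![apply: integrableD => //];
      apply: integrable_abse; exact: KU.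
  have mphi := measurable_coord_rV phi_meas i.
  have : mu.-integrable [set: Z] (fun z => (c * (phi z ord0 i * g z))%:E).
    apply: (@le_integrable _ _ _ mu _ measurableT _ W) => // [|z _].
      by apply/measurable_EFinP; do 2 apply: measurable_funM => //.
    apply: le_trans (lee_abs _).
    have := Kge (theta0 - c *: delta_mx ord0 i)%R z.
    have := Kge (theta0 + c *: delta_mx ord0 i)%R z.
    have := Kge theta0 z; have := gmax z.
    rewrite /W /Kint -scaleNr !innerDZ_delta bE; have := e0 z.
    (* A conjugate equal to [+oo] makes [W z = +oo]; the value [-oo] contradicts [Kge], as
       [beta z (g z)] is finite. *)
    case: (conjugate _ (_ + c * _)) => [k1| |]; last 2 first.
    - by move=> *; rewrite /= !addye ?abse_neqNy// leey.
    - by rewrite -EFinB.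
    case: (conjugate _ (_ + - c * _)) => [k2| |]; last 2 first.
    - by move=> *; rewrite /= addey// !addye ?abse_neqNy// leey.
    - by rewrite -EFinB.
    case: (conjugate _ (inner _ _)) => [k| |]; last 2 first.
    - by move=> *; rewrite /= -EFinD addey// addye// leey.
    - by rewrite -EFinB.
    (* Combining [k0] with [k4] and [k5] bounds [c phi_i g] by [k1 - k + e] and its opposite by
       [k2 - k + e]. *)
    move=> ez /(_ isT); rewrite -!EFinB -!EFinD !lee_fin => k0 k3 k4 k5.
    have := (ler_norm k1, normr_ge0 k1, ler_norm k2, normr_ge0 k2).
    move=> [[[? ?] ?] ?].
    have := ler_norm k; have := ler_norm (- k)%R; rewrite normrN.
    by move=> *; rewrite ler_norml; apply/andP; split; lra.
  move=> /(integrableZl measurableT c^-1); apply: eq_integrable => // z _.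
  by rewrite -EFinM mulKf// gt_eqF.
exists g; split => //.
(* With [r = <theta0, phi z>] and [k] the conjugate there,
   [r g - k <= beta z (g z) <= r g - k + e]. *)
pose W z := `|(inner theta0 (phi z) * g z)%:E| + `|Kint theta0 z| + (e z)%:E.
have iW : mu.-integrable [set: Z] W.
  apply: integrableD => //; apply: integrableD => //; apply: integrable_abse.
    exact: integrable_inner_mul.
  exact: KU.
apply: (@le_integrable _ _ _ mu _ measurableT _ W) => // z _.
apply: le_trans (lee_abs _).
have := Kge theta0 z; have := gmax z; rewrite /W /Kint bE.
have := e0 z; case: (conjugate _ _) => [k| |]; last 2 first.
- by move=> *; rewrite /= addey// addye// leey.
- by rewrite -EFinB.
move=> ez /(_ isT); rewrite -!EFinB -!EFinD !lee_fin => k0 k1.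
have := ler_norm k; have := ler_norm (- k)%R; rewrite normrN.
have := ler_norm (inner theta0 (phi z) * g z).
have := ler_norm (- (inner theta0 (phi z) * g z))%R; rewrite normrN.
by move=> *; rewrite ler_norml; apply/andP; split; lra.
Qed.

End convex_integrand.

(** * Sequential lower semicontinuity and lower limits *)

(** Otherwise each ball of radius [1 / (n + 1)] about [x] contains a point where [f] is at most [a],
    and these points converge to [x]. The sequential form is what Fatou's lemma can use. *)
Lemma lower_semicontinuous_seq (R : realType) (X : pseudoMetricType R)
    (f : X -> \bar R) :
  (forall x a (u : nat -> X), u @ \oo --> x -> (forall n, f (u n) <= a%:E) ->
    f x <= a%:E) ->
  lower_semicontinuous f.
Proof.
move=> H x a ax; apply: contrapT => nV.
have ex n : exists y, ball x n.+1%:R^-1 y /\ f y <= a%:E.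
  apply: contrapT => ny; apply: nV; exists (ball x n.+1%:R^-1).
    by apply: nbhsx_ballx; rewrite invr_gt0.
  move=> y xy; rewrite ltNge; apply/negP => fy.
  by apply: ny; exists y.
have [u ux] := choice ex.
suff /H/(_ (fun n => (ux n).2)) : u @ \oo --> x by rewrite leNgt ax.
apply/cvg_ballP => eps eps0; near=> n.
apply: le_ball (ux n).1.
rewrite ltW//; near: n; exact: near_infty_natSinv_lt (PosNum eps0).
Unshelve. all: by end_near. Qed.

Lemma le_limn_einf (R : realType) (u : (\bar R)^nat) (x : \bar R) :
  (forall c : R, c%:E < x -> \forall n \near \oo, c%:E <= u n) ->
  x <= limn_einf u.
Proof.
move=> xu; apply: lee_lt_EFin => c /xu[N _ Nu].
rewrite limn_einf_lim (cvg_lim _ (@cvg_einfs_sup _ u))//.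
apply: le_ereal_sup_tmp; exists (einfs u N); first by exists N.
by apply: le_ereal_inf_tmp => _ [k /= Nk <-]; exact: Nu.
Qed.

Lemma limn_einf_le_cvg (R : realType) (u v : (\bar R)^nat) (l : \bar R) :
  (forall n, u n <= v n) -> v @ \oo --> l -> limn_einf u <= l.
Proof.
move=> uv vl; rewrite limn_einf_lim -(cvg_lim _ vl)//.
apply: lee_lim; [exact: is_cvg_einfs|by apply/cvg_ex; exists l|].
apply: nearW => n; apply: le_trans (uv n).
by apply: ereal_inf_lbound; exists n => /=.
Qed.

(** * Lower bound for [Jfun] and lower semicontinuity of [Kfun] *)

Section moment_problem.
Context (R : realType) d (Z : measurableType d) (n : nat).
Variables (mu : {measure set Z -> \bar R}) (phi : Z -> 'rV[R]_n).
Variable beta : Z -> R -> \bar R.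
Hypotheses (betaB : classB beta) (phi_meas : measurable_rV phi).

Let Kint theta z := conjugate (beta z) (inner theta (phi z)).

Let mKint theta : measurable_fun [set: Z] (Kint theta).
Proof. exact/measurable_conjugate/measurable_inner. Qed.

Lemma Jfun_neqNy theta a : Kfun mu phi beta theta \is a fin_num ->
  Jfun mu phi beta a != -oo.
Proof.
move=> Kfin; have iK := Kfun_fin_num_integrable betaB phi_meas Kfin.
rewrite gt_eqF//.
(* This is the integral of the Fenchel minorant, the same for all [g] with moment [a]. *)
rewrite (@lt_le_trans _ _ ((inner theta a)%:E - \int[mu]_z Kint theta z))//.
  have := integrable_fin_num measurableT iK; rewrite /Kint.
  by case: (integral _ _ _) => // k _; rewrite -EFinB ltNyr.
apply: le_ereal_inf_tmp => _ [g [Gg g0] <-].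
have ig := integrable_inner_mul theta Gg.1.
rewrite -(integral_inner_mul theta Gg) -integralB//.
apply: le_integral_pintegral => [|z]; first exact: integrableB.
have := conjugate_ubound (beta z) (inner theta (phi z)) (g z).
have := Gamma_neqNy (g z) (betaB.2 z); rewrite /Kint.
case: (beta z (g z)) => [b| |]//; last by rewrite leey.
case: (conjugate _ _) => [k| |]//; last by rewrite leNye.
by rewrite -!EFinB !lee_fin; lra.
Qed.

Lemma Kfun_lower_semicontinuous g : momG mu phi g ->
  mu.-integrable [set: Z] (fun z => beta z (g z)) ->
  (forall z, (0 < g z)%R) ->
  lower_semicontinuous (Kfun mu phi beta).
Proof.
move=> Gg ib g0; apply: lower_semicontinuous_seq => x a u ux Ku.
pose b z := fine (beta z (g z)).
have bE z : beta z (g z) = (b z)%:E.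
  by rewrite /b fineK// (Gamma_fin_num (betaB.2 z)).
pose h theta z := (inner theta (phi z) * g z - b z)%:E.
have hE theta z : h theta z = (inner theta (phi z) * g z)%:E - beta z (g z).
  by rewrite bE.
have ih theta : mu.-integrable [set: Z] (h theta).
  rewrite (_ : h theta = fun z => (inner theta (phi z) * g z)%:E - beta z (g z)).
    by apply: integrableB => //; exact: integrable_inner_mul.
  by apply/funext.
have hK theta z : h theta z <= Kint theta z.
  by rewrite hE; exact: conjugate_ubound.
pose F theta z := Kint theta z - h theta z.
have F0 theta z : 0 <= F theta z by rewrite sube_ge0// orbT.
have mF theta : measurable_fun [set: Z] (F theta).
  by apply: emeasurable_funB; [exact: mKint|exact: measurable_int (ih theta)].
have iKu k : mu.-integrable [set: Z] (Kint (u k)).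
  apply: (pintegral_lty_integrable (ih (u k))) => //.
  by apply: le_lt_trans (Ku k) _; rewrite ltry.
pose m i := \int[mu]_z (phi z ord0 i * g z)%:E.
pose moment : 'rV[R]_n := \row_i fine (m i).
have Ga : momGa mu phi moment g.
  split=> // i; rewrite mxE fineK//.
  by apply: integrable_fin_num => //; exact: Gg.2.
have ibfin := integrable_fin_num measurableT ib.
pose L theta := (inner theta moment - fine (\int[mu]_z beta z (g z)))%R.
have hL theta : \int[mu]_z h theta z = (L theta)%:E.
  under eq_integral do rewrite hE.
  rewrite integralB//; last exact: integrable_inner_mul.
  by rewrite (integral_inner_mul theta Ga) /L EFinB fineK.
have cvginner v : inner (u k) v @[k --> \oo] --> inner x v.
  exact: (cvg_comp _ _ ux (@continuous_innerl _ _ v x)).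
(* Subtracting the minorant turns the bound [a] on [Kfun] into one that is continuous in [theta],
   since [L] is affine. *)
have Fu k : \int[mu]_z F (u k) z <= (a - L (u k))%:E.
  rewrite integralB// hL [leRHS]EFinB leeB//.
  by apply: le_trans (Ku k); rewrite /Kfun pintegral_integrable//; exact: iKu.
have Fx : \int[mu]_z F x z <= (a - L x)%:E.
  apply: (@le_trans _ _ (\int[mu]_z limn_einf (fun k => F (u k) z))).
    (* Pointwise lower semicontinuity of [F] in [theta]: for [c] below [F x z], one rational [t]
       yields a function [w], affine in [theta], with [w <= F] at [z] and [c < w x]; continuity of
       [w] carries [c] to nearby [u i]. *)
    apply: ge0_le_integral_nonmeas => // z; apply: le_limn_einf => c.
    rewrite /F lteBrDr// -EFinD.
    move=> /(Gamma_conjugate_approx (betaB.2 z))[k].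
    have := Gamma_fin_num (betaB.2 z) (posrat_gt0 k).
    set t := posrat k; case bt: (beta z t) => [bt'| |]// _.
    pose w v := (inner v (phi z) * t - bt' - (inner v (phi z) * g z - b z))%R.
    rewrite -EFinB lte_fin -ltrBrDr -/(w x) => cw.
    have wux : w (u i) @[i --> \oo] --> w x.
      apply: cvgB; (apply: cvgB; last exact: cvg_cst);
        by apply: cvgMr_tmp; exact: cvginner.
    near=> i; apply: (@le_trans _ _ (w (u i))%:E).
      by rewrite lee_fin ltW//; near: i; exact: cvgr_gt wux _ cw.
    rewrite EFinB leeB// EFinB -bt; exact: conjugate_ubound.
  apply: (le_trans (fatou _ _ _ _)) => //.
  apply: (limn_einf_le_cvg Fu); apply: cvg_EFin; first exact: nearW.
  apply: cvgB; first exact: cvg_cst.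
  by apply: cvgB; [exact: cvginner|exact: cvg_cst].
(* Adding the minorant back cancels [L x] and leaves the bound [a] at the limit point. *)
have KE z : Kint x z = F x z + h x z by rewrite /F subeK.
have iF : mu.-integrable [set: Z] (F x).
  apply/integrableP; split => //.
  under eq_integral do rewrite gee0_abs//.
  by rewrite (le_lt_trans Fx)// ltry.
have iK : mu.-integrable [set: Z] (Kint x).
  by rewrite (_ : Kint x = F x \+ h x); [exact: integrableD|apply/funext].
rewrite /Kfun pintegral_integrable//.
rewrite (eq_integral (fun z => F x z + h x z)); last by move=> z _; exact: KE.
by rewrite integralD// hL -leeBrDr.
Unshelve. all: by end_near. Qed.

End moment_problem.

Theorem corollary3p11 (R : realType) (disp : measure_display)
    (Z : measurableType disp) (mu : {sigma_finite_measure set Z -> \bar R})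
    (d : nat) (phi : Z -> 'rV[R]_d) (beta : Z -> R -> \bar R)
    (phi_meas : measurable_rV phi)
    (betaB : classB beta)
    (K_finite : exists U : set 'rV[R]_d,
        [/\ open U, U !=set0 &
            forall theta, U theta -> Kfun mu phi beta theta \is a fin_num]) :
  proper_ereal (Jfun mu phi beta) /\ lower_semicontinuous (Kfun mu phi beta).
Proof.
have [U [openU U0 KU]] := K_finite.
have [g [Gg g0 ib]] := finite_cost_density betaB phi_meas
  (sigma_finiteT mu) openU U0 KU.
split; last exact: Kfun_lower_semicontinuous Gg ib g0.
split; last first.
  move=> a; have [theta Utheta] := U0.
  by apply: Jfun_neqNy (KU _ Utheta).
(* The moment vector of [g]; [fine] loses nothing because every [phi_i g] is integrable. *)
exists (\row_i fine (\int[mu]_z (phi z ord0 i * g z)%:E)).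
have Ga : momGaplus mu phi
    (\row_i fine (\int[mu]_z (phi z ord0 i * g z)%:E)) g.
  split; last by move=> z; exact: ltW.
  split=> // i; rewrite mxE fineK//.
  by apply: integrable_fin_num => //; exact: Gg.2.
rewrite lt_eqF// (@le_lt_trans _ _ (Hfun mu beta g))//.
  by apply: ereal_inf_lbound; exists g.
rewrite /Hfun pintegral_integrable//.
by have /fin_numPlt/andP[] := integrable_fin_num measurableT ib.
Qed.
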